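(* Let $C>1$ be a constant and let $t\ge 5C$ be an integer. For every $i\in[t]$ let $H_i$ be a connected $d_i$-regular graph with $1<|V(H_i)|\le C$. Let $G=\square_{i=1}^t H_i$ and suppose that $|V(G)|$ is even. Then $G$ has a perfect matching.
   Context: The Cartesian product $G=\square_{i=1}^t H_i$ is the graph with vertex set $V(H_1)\times\cdots\times V(H_t)$ in which $u=(u_1,\dots,u_t)$ and $v=(v_1,\dots,v_t)$ are adjacent if and only if there is an index $i\in[t]$ such that $u_j=v_j$ for all $j\neq i$ and $\{u_i,v_i\}\in E(H_i)$. *)

(* Defs.v *)
From HB Require Import structures.
From mathcomp Require Import all_boot all_order all_algebra.
From mathcomp Require Import reals.

Set Implicit Arguments.
Unset Strict Implicit.
Unset Printing Implicit Defensive.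

Record sgraph := SGraph {
  vertex :> finType;
  adj : rel vertex;
  adj_sym : symmetric adj;
  adj_irrefl : irreflexive adj
}.

Definition edges (G : sgraph) : {set {set G}} :=
  [set [set p.1; p.2] | p : G * G & adj p.1 p.2].

Definition regular (G : sgraph) (d : nat) : Prop :=
  forall x : G, #|[set y | adj x y]| = d.

Definition connected_graph (G : sgraph) : Prop :=
  0 < #|G| /\ forall x y : G, connect (@adj G) x y.

Definition matching (G : sgraph) (M : {set {set G}}) : Prop :=
  M \subset edges G /\ trivIset M.

Definition perfect_matching (G : sgraph) (M : {set {set G}}) : Prop :=
  matching M /\ cover M = [set: G].

Section CartesianProduct.
Variables (t : nat) (H : 'I_t -> sgraph).

Definition cart_adj (u v : {dffun forall i : 'I_t, H i}) : bool :=
  [exists i : 'I_t,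
     [forall j : 'I_t, (j != i) ==> (u j == v j)] && adj (u i) (v i)].

Fact cart_adj_sym : symmetric cart_adj.
Proof.
move=> u v; apply/existsP/existsP => -[i /andP[/forallP uv a]];
  exists i; rewrite adj_sym a andbT; apply/forallP => j;
  by rewrite eq_sym [X in _ ==> X]eq_sym eq_sym; apply: uv.
Qed.

Fact cart_adj_irrefl : irreflexive cart_adj.
Proof. by move=> u; apply/existsP => -[i]; rewrite adj_irrefl andbF. Qed.

Definition cart_prod : sgraph := SGraph cart_adj_sym cart_adj_irrefl.

End CartesianProduct.

(* Main.v *)
Require Import Defs.
From mathcomp Require Import all_boot all_order all_algebra.
From mathcomp Require Import perm.
From mathcomp Require Import reals.

Set Implicit Arguments.
Unset Strict Implicit.
Unset Printing Implicit Defensive.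

Import Order.TTheory GRing.Theory Num.Theory.

(** By Hall's theorem a regular graph of positive degree has a permutation
    moving every vertex to a neighbour. Its even orbits have a perfect matching,
    its odd orbits are factor-critical, and both properties pass to products:
    one matchable factor makes the product matchable, and a product of
    factor-critical graphs is factor-critical. As |V(G)| is even, some [H i0]
    has even order; cut G into the pieces [H i0] x (product of orbits of the
    other factors). If one of these orbits is even, the piece is matchable.
    Otherwise the piece is [H i0] x K with K factor-critical and |K| >= t. There,
    leaves of [H i0] are removed one at a time: a fibre {x} x K is matched
    internally except for an odd number of points, which are matched to
    neighbouring fibres. This is possible since, in a factor-critical K, every
    point belongs to sets R of each odd size m <= |K| such that K - R is
    matchable (remove the point, then (m - 1)/2 edges of the matching). *)

(** A perfect matching of [S] is encoded as an involution of [S] along edges; values of [f] outside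
    [S] are unconstrained. *)
Definition matchable (T : finType) (e : rel T) (S : {set T}) : Prop :=
  exists f : T -> T,
    {in S, forall x, [/\ f x \in S, f (f x) = x & e x (f x)]}.

Definition factor_critical (T : finType) (e : rel T) (S : {set T}) : Prop :=
  {in S, forall p, matchable e (S :\ p)}.

(** * Matchings as involutions *)

Section Matchable.
Variables (T : finType) (e : rel T).
Implicit Types A B S : {set T}.

Lemma matchable0 : matchable e set0.
Proof. by exists id => x; rewrite inE. Qed.

(** Each [f k] keeps its own class of [b], so the map that applies [f (b x)] at [x] is still an
    involution. *)
Lemma matchable_bigcup (I : finType) (b : T -> I) S :
  (forall k, matchable e [set x in S | b x == k]) -> matchable e S.
Proof.
move=> /fin_all_exists[f fP]; exists (fun x => f (b x) x) => x xS.
have /fP[] : x \in [set y in S | b y == b x] by rewrite inE xS eqxx.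
by rewrite inE => /andP[-> /eqP->].
Qed.

Lemma matchableU A B :
  [disjoint A & B] -> matchable e A -> matchable e B -> matchable e (A :|: B).
Proof.
move=> dAB mA mB; apply: (@matchable_bigcup _ (mem A)) => -[].
  suff -> : [set x in A :|: B | (x \in A) == true] = A by [].
  by apply/setP => x; rewrite !inE; case: (x \in A); rewrite ?andbF.
suff -> : [set x in A :|: B | (x \in A) == false] = B by [].
apply/setP => x; rewrite !inE; case: (boolP (x \in A)) => //= [xA|_].
  by rewrite (disjointFr dAB xA).
by rewrite andbT.
Qed.

Hypothesis e_sym : symmetric e.
Hypothesis e_irr : irreflexive e.

Lemma matchable2 x y : e x y -> matchable e [set x; y].
Proof.
move=> exy; have xy : x == y = false by apply: contraTF exy => /eqP->; rewrite e_irr.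
exists (fun z => if z == x then y else x) => z; rewrite !inE.
by case/orP=> /eqP->; rewrite ?eqxx ?[y == x]eq_sym xy ?eqxx ?orbT // e_sym.
Qed.

(** Vertices are split off two at a time from the front; [odd (size s)] makes the number of vertices
    even once [x] is counted. *)
Lemma matchable_path x s :
  path e x s -> uniq (x :: s) -> odd (size s) -> matchable e [set:: x :: s].
Proof.
have [n] := ubnP (size s); elim: n x s => // n IHn x [|y [|z s]] //= ltn.
  rewrite andbT => exy _ _.
  have -> : [set:: [:: x; y]] = [set x; y] by apply/setP=> u; rewrite !inE.
  exact: matchable2.
move=> /and3P[exy _ p] /and3P[xs ys uzs]; rewrite negbK => os.
have -> : [set:: [:: x, y, z & s]] = [set x; y] :|: [set:: z :: s].
  by apply/setP=> u; rewrite !inE orbA.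
apply: matchableU; [|exact: matchable2|by apply: IHn => //; apply: ltnW].
rewrite disjoint_sym disjoint_subset; apply/subsetP=> u; rewrite !inE => us.
apply/norP; split; apply: contraNneq xs => ?; subst u; rewrite !inE; first by rewrite us !orbT.
by move: ys; rewrite inE us.
Qed.

Lemma matchable_remove S k : matchable e S -> k.*2 <= #|S| ->
  exists2 R : {set T}, R \subset S & #|R| = k.*2 /\ matchable e (S :\: R).
Proof.
case=> f fP; elim: k => [|k IHk] lek.
  by exists set0; rewrite ?sub0set // cards0 setD0; split=> //; exists f.
(* Take [R] closed under [f], a union of matched pairs: then [f] also preserves the complement of
   [R]. *)
suff: exists2 R : {set T}, R \subset S &
   #|R| = k.+1.*2 /\ {in R, forall x, f x \in R}.
  case=> R sRS [cR Rf]; exists R => //; split=> //; exists f => x.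
  rewrite !inE => /andP[xR xS]; have [fS ff ex] := fP x xS; split=> //.
  by rewrite fS andbT; apply: contra xR => /Rf; rewrite ff.
elim: k.+1 lek => {k IHk}[|k IHk] lek.
  by exists set0; rewrite ?sub0set ?cards0; split=> // x; rewrite inE.
have [|R sRS [cR Rf]] := IHk; first by apply: leq_trans lek; rewrite leq_double.
have [x] : exists x, x \in S :\: R.
  apply/set0Pn; rewrite -card_gt0 cardsD (setIidPr sRS) cR subn_gt0.
  by apply: leq_trans lek; rewrite ltn_double.
rewrite inE => /andP[xR xS]; have [fS ff ex] := fP x xS.
have fR : f x \notin R by apply: contra xR => /Rf; rewrite ff.
have xf : x != f x by apply: contraTneq ex => <-; rewrite e_irr.
exists (x |: (f x |: R)).
  by rewrite !subUset !sub1set xS fS.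
split; first by rewrite !cardsU1 !inE negb_or xf xR fR cR.
move=> y; rewrite !inE => /or3P[/eqP->|/eqP->|/Rf->]; rewrite ?ff ?eqxx ?orbT //.
Qed.

Lemma factor_critical_remove S p m : factor_critical e S -> p \in S ->
  odd m -> m <= #|S| ->
  exists2 R : {set T}, p \in R /\ R \subset S &
    #|R| = m /\ matchable e (S :\: R).
Proof.
move=> fcS pS om lem; have [||R sR [cR mR]] := @matchable_remove (S :\ p) m./2.
- exact: fcS.
- by rewrite -ltnS; move: lem; rewrite (cardsD1 p) pS -{1}(odd_double_half m) om.
exists (p |: R).
  by rewrite setU11 subUset sub1set pS (subset_trans sR) ?subD1set.
have pR : p \notin R by apply/negP=> /(subsetP sR); rewrite !inE eqxx.
split; first by rewrite cardsU1 pR cR -[RHS]odd_double_half om.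
by rewrite -setDDl.
Qed.

End Matchable.

Lemma matchable_imset (T T' : finType) (e : rel T) (e' : rel T') (g : T -> T')
    (A : {set T}) :
  {in A &, injective g} -> {in A &, {homo g : x y / e x y >-> e' x y}} ->
  matchable e A -> matchable e' (g @: A).
Proof.
move=> gI ge [f fP].
(* [f] is transported along [g]; the default [z] is only reached outside [g @: A]. *)
pose h z := if [pick x in A | g x == z] is Some x then g (f x) else z.
have hE x : x \in A -> h (g x) = g (f x).
  move=> xA; rewrite /h; case: pickP => [y /andP[yA /eqP]|/(_ x)].
    by move/gI => ->.
  by rewrite xA eqxx.
exists h => _ /imsetP[x xA ->]; have [fA ff ex] := fP x xA.
by rewrite !hE // ff imset_f //; split=> //; apply: ge.
Qed.

(** * Hall's theorem and regular graphs *)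

Section Hall.
Variables (T U : finType) (r : T -> U -> bool).

Definition neighbours (B : {set T}) : {set U} := [set y | [exists x in B, r x y]].

Lemma neighboursP (B : {set T}) y : reflect (exists2 x, x \in B & r x y) (y \in neighbours B).
Proof. by rewrite inE; apply: exists_inP. Qed.

Lemma neighboursU (A B : {set T}) : neighbours (A :|: B) = neighbours A :|: neighbours B.
Proof.
apply/setP => y; rewrite in_setU; apply/neighboursP/orP.
  by case=> x /setUP[xA|xB] rxy; [left|right]; apply/neighboursP; exists x.
by case=> /neighboursP[x xA rxy]; exists x => //; rewrite inE xA ?orbT.
Qed.

(** Induction on [#|A|]. If a nonempty proper subset [B] is tight, [B] and [A :\: B] are matched
    separately, the latter avoiding the neighbours of [B]. Otherwise any [a] may take any allowed
    neighbour [b]. The target set [W] is a parameter so that used vertices can be deleted from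
    it. *)
Lemma hall (f0 : T -> U) (A : {set T}) (W : {set U}) :
  (forall B : {set T}, B \subset A -> #|B| <= #|neighbours B :&: W|) ->
  exists f : T -> U, {in A &, injective f} /\
    {in A, forall x, r x (f x) && (f x \in W)}.
Proof.
have [n] := ubnP #|A|; elim: n A W => // n IHn A W; rewrite ltnS => leA hallA.
have [A0|[a aA]] := set_0Vmem A.
  by exists f0; rewrite A0; split=> [x y|x]; rewrite inE.
have [/existsP[B /and3P[prB B0 tight]]|/existsPn slack] :=
  boolP [exists B : {set T},
           [&& B \proper A, B != set0 & #|neighbours B :&: W| <= #|B|]].
  have sBA := proper_sub prB.
  have [||f [fI fP]] := IHn B W.
  - exact: leq_trans (proper_card prB) leA.
  - by move=> D sDB; apply: hallA; apply: subset_trans sBA.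
  have [||g [gI gP]] := IHn (A :\: B) (W :\: neighbours B).
  - apply: leq_trans leA; rewrite -(cardsID B A) (setIidPr sBA).
    by rewrite -[X in X < _]add0n ltn_add2r card_gt0.
  - move=> D sD; have dBD : [disjoint B & D].
      rewrite disjoint_sym disjoint_subset; apply/subsetP => x /(subsetP sD).
      by rewrite !inE => /andP[].
    (* Hall's condition for [D] in the smaller problem is the one for [B :|: D] minus the tight
       count for [B]. *)
    have: #|B :|: D| <= #|neighbours (B :|: D) :&: W|.
      by apply: hallA; rewrite subUset sBA (subset_trans sD) ?subsetDl.
    rewrite cardsU (disjoint_setI0 dBD) cards0 subn0 neighboursU => le1.
    rewrite -(leq_add2l #|B|); apply: leq_trans le1 _.
    apply: leq_trans (leq_add tight (leqnn _)); apply: leq_trans (leq_card_setU _ _).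
    apply: subset_leq_card; apply/subsetP => y; rewrite !(in_setI, in_setU, in_setD).
    by case: (y \in neighbours B); case: (y \in neighbours D); case: (y \in W).
  have Nf x : x \in B -> f x \in neighbours B.
    by move=> xB; have /andP[? _] := fP x xB; apply/neighboursP; exists x.
  have NgD x : x \in A -> x \notin B -> [/\ r x (g x), g x \in W & g x \notin neighbours B].
    move=> xA xB; have /gP : x \in A :\: B by rewrite inE xA xB.
    by rewrite in_setD => /and3P[].
  exists (fun x => if x \in B then f x else g x); split=> [x y xA yA|x xA] /=.
    case: ifPn => xB; case: ifPn => yB.
    - exact: fI.
    - by move=> E; have [_ _] := NgD y yA yB; rewrite -E Nf.
    - by move=> E; have [_ _] := NgD x xA xB; rewrite E Nf.
    - by apply: gI; rewrite inE ?xB ?yB.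
  case: ifPn => xB; first exact: fP.
  by have [-> ->] := NgD x xA xB.
have [b] : exists b, b \in neighbours [set a] :&: W.
  apply/set0Pn; rewrite -card_gt0; apply: leq_trans (hallA [set a] _).
    by rewrite cards1.
  by rewrite sub1set.
rewrite in_setI => /andP[/neighboursP[_ /set1P-> rab] bW].
have [||f [fI fP]] := IHn (A :\ a) (W :\ b).
- by apply: leq_trans leA; rewrite [#|A|](cardsD1 a) aA.
- move=> D sD; have [->|D0] := eqVneq D set0; first by rewrite cards0.
  have prD : D \proper A.
    rewrite properE (subset_trans sD) ?subD1set //=.
    by apply/negP => /subsetP/(_ a aA)/(subsetP sD); rewrite !inE eqxx.
  (* [D] has strictly more than [#|D|] allowed neighbours, so losing [b] does no harm. *)
  have := slack D; rewrite prD D0 /= -ltnNge setIDA (cardsD1 b (_ :&: _)).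
  by case: (b \in _) => //= /ltnW.
exists (fun x => if x == a then b else f x).
have fb x : x \in A -> x != a -> [/\ r x (f x), f x \in W & f x != b].
  move=> xA xa; have /fP : x \in A :\ a by rewrite !inE xa.
  by rewrite in_setD1 => /and3P[].
split=> [x y xA yA|x xA] /=.
  have [->|xa] := eqVneq x a; have [->|ya] := eqVneq y a => //.
  - by move=> E; have [_ _] := fb y yA ya; rewrite E eqxx.
  - by move=> E; have [_ _] := fb x xA xa; rewrite E eqxx.
  - by apply: fI; rewrite !inE ?xa ?ya.
have [->|xa] := eqVneq x a; first by rewrite rab.
by have [-> ->] := fb x xA xa.
Qed.

End Hall.

Lemma regular_perm (G : sgraph) d : regular G d -> 0 < d ->
  exists s : {perm G}, forall x, adj x (s x).
Proof.
move=> regG d0; have [B _|f [fI fP]] := @hall G G (@adj G) id setT setT.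
  (* Hall's condition by double counting: [d * #|B|] edges leave [B], and each vertex of its
     neighbourhood receives at most [d] of them. *)
  rewrite setIT -(leq_pmul2r d0).
  have deg (x : G) : \sum_(y | adj x y) 1 = d.
    by rewrite -(regG x) -sum1_card; apply: eq_bigl => y; rewrite inE.
  rewrite -sum_nat_const -[X in _ <= X]sum_nat_const.
  rewrite (eq_bigr _ (fun x _ => esym (deg x))).
  rewrite [X in _ <= X](eq_bigr _ (fun x _ => esym (deg x))).
  rewrite (exchange_big_dep (mem (neighbours (@adj G) B))) /=.
    apply: leq_sum => y _.
    rewrite big_mkcond [X in _ <= X]big_mkcond /=; apply: leq_sum => x _.
    by rewrite adj_sym; case: (x \in B); case: (adj y x).
  by move=> x y xB xy; apply/neighboursP; exists x.
have fI' : injective f by move=> x y; apply: fI; rewrite inE.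
by exists (perm fI') => x; rewrite permE; have /fP/andP[] : x \in setT by [].
Qed.

(** * Orbits of a permutation that moves along edges *)

Section Orbits.
Variables (T : finType) (e : rel T) (s : {perm T}).
Hypothesis e_sym : symmetric e.
Hypothesis e_irr : irreflexive e.
Hypothesis es : forall x, e x (s x).

Lemma path_traject x n : path e x (traject s (s x) n).
Proof. by elim: n x => //= n IHn x; rewrite es IHn. Qed.

Lemma porbit_set x n : #|porbit s x| = n ->
  porbit s x = [set:: traject s x n] /\ uniq (traject s x n).
Proof.
move=> <-; split; last exact: uniq_traject_porbit.
by apply/setP => y; rewrite inE porbit_traject.
Qed.

(** Listing the orbit from [x] by iterating [s] gives a path through all of it, with an even number
    of vertices. *)
Lemma matchable_porbit x : ~~ odd #|porbit s x| -> matchable e (porbit s x).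
Proof.
case E: #|porbit s x| => [|n] o; have [-> U] := porbit_set E.
  have -> : [set:: [::]] = set0 :> {set T} by apply/setP=> y; rewrite !inE.
  exact: matchable0.
apply: matchable_path => //; first exact: path_traject.
by rewrite size_traject; move: o; rewrite /= negbK.
Qed.

(** With the orbit listed from the deleted point [p], the remaining points form a path with an even
    number of vertices, possibly none. *)
Lemma factor_critical_porbit x :
  odd #|porbit s x| -> factor_critical e (porbit s x).
Proof.
move=> o p; rewrite -eq_porbit_mem => /eqP px; rewrite -{}px in o *.
move: o; case E: #|porbit s p| => [//|n] o; have [-> /= /andP[pn U]] := porbit_set E.
have -> : [set:: p :: traject s (s p) n] :\ p = [set:: traject s (s p) n].
  apply/setP => y; rewrite !inE; case: eqVneq => //= ->.
  by rewrite (negPf pn).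
case: n {E pn} U o => [|n] U o.
  have -> : [set:: [::]] = set0 :> {set T} by apply/setP=> y; rewrite !inE.
  exact: matchable0.
apply: matchable_path => //; first exact: path_traject.
by rewrite size_traject; move: o; rewrite /= negbK.
Qed.

End Orbits.

(** * Product of a connected graph with a factor-critical set *)

Section GrowProduct.
Variables (V K : finType) (eV : rel V) (eK : rel K).
Hypothesis eV_sym : symmetric eV.
Hypothesis eV_irr : irreflexive eV.
Hypothesis eK_sym : symmetric eK.
Hypothesis eK_irr : irreflexive eK.

Definition box_rel : rel (V * K) := fun u v =>
  (u.1 == v.1) && eK u.2 v.2 || (u.2 == v.2) && eV u.1 v.1.

Lemma box_rel_sym : symmetric box_rel.
Proof.
by move=> u v; rewrite /box_rel [u.1 == _]eq_sym [u.2 == _]eq_sym eK_sym eV_sym.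
Qed.

Lemma box_rel_irrefl : irreflexive box_rel.
Proof. by move=> u; rewrite /box_rel eV_irr eK_irr !andbF. Qed.

(** Every vertex but the last has a neighbour later in the list, so the head can be removed as a
    leaf of a spanning tree of the listed vertices. *)
Fixpoint grown (s : seq V) : bool :=
  if s is x :: s' then (nilp s' || has (eV x) s') && grown s' else true.

Lemma connected_grown : (forall x y, connect eV x y) ->
  exists s : seq V, [/\ uniq s, grown s & forall x, x \in s].
Proof.
move=> conn; suff grow n : n <= #|V| -> exists s, [/\ uniq s, grown s & size s = n].
  have [s [us gs cs]] := grow _ (leqnn _); exists s; split=> // x.
  have E : #|s| = #|V| by rewrite (card_uniqP us).
  have /(subset_cardP E) -> // : s \subset V by apply/subsetP => y.
elim: n => [_|n IHn ltn]; first by exists [::].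
have [s [us gs cs]] := IHn (ltnW ltn).
suff [x xs nx] : exists2 x, x \notin s & nilp s || has (eV x) s.
  by exists (x :: s); rewrite /= xs us nx gs cs.
have [x xs] : exists x, x \notin s.
  apply/existsP; rewrite -negb_forall; apply/negP => /forallP sT.
  move: ltn; rewrite -cs ltnNge; case/negP.
  by apply: leq_trans (card_size s); apply: subset_leq_card; apply/subsetP => y _.
case: s us gs cs xs => [|y s] us gs cs xs; first by exists x.
have [/exists_inP[z zs zy]|/exists_inPn noe] :=
  boolP [exists z in [pred z | z \notin y :: s], has (eV z) (y :: s)].
  by exists z => //; rewrite zy orbT.
(* If no new vertex touches the list, the list is closed under adjacency; connectedness then puts
   [x] in it, a contradiction. *)
have cl : closed eV (mem (y :: s)).
  apply: intro_closed; first exact: sym_connect_sym.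
  move=> u v uv us'; apply/negPn/negP => /noe/hasP[]; exists u => //.
  by rewrite eV_sym.
have := closed_connect cl (conn y x).
by rewrite [RHS](negPf xs) [LHS]inE eqxx.
Qed.

Lemma matchable_fiber x (A : {set K}) :
  matchable eK A -> matchable box_rel [set u | (u.1 == x) && (u.2 \in A)].
Proof.
move=> mA; have -> : [set u | (u.1 == x) && (u.2 \in A)] = (pair x) @: A.
  apply/setP => -[y k]; rewrite inE /=; apply/andP/imsetP.
    by case=> /eqP-> kA; exists k.
  by case=> l lA [-> ->]; rewrite eqxx.
apply: matchable_imset mA => [k l _ _ [] //|k l _ _ kl].
by rewrite /box_rel /= eqxx kl.
Qed.

Variable S : {set K}.
Hypothesis S_fc : factor_critical eK S.

Lemma fiber_remove m k : k \in S -> odd m -> m <= #|S| ->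
  exists R : {set K},
    [/\ k \in R, R \subset S, #|R| = m & matchable eK (S :\: R)].
Proof.
move=> kS om lem.
by have [R [kR sR] [cR mR]] := factor_critical_remove eK_irr S_fc kS om lem; exists R.
Qed.

(* [c x] counts the points of the fibre over [x] that must be left uncovered,
   to be matched to fibres over leaves removed earlier. *)
Lemma matchable_grown s (c : V -> nat) :
  uniq s -> grown s -> s != [::] ->
  ~~ odd (\sum_(x <- s) (c x).+1) -> \sum_(x <- s) (c x).+1 <= #|S|.+1 ->
  exists R : V -> {set K},
    {in s, forall x, R x \subset S /\ #|R x| = c x} /\
    matchable box_rel [set u | (u.1 \in s) && (u.2 \in S :\: R u.1)].
Proof.
have Sn0 m : 0 < m <= #|S| -> exists k, k \in S.
  by case/andP => m0 mS; apply/set0Pn; rewrite -card_gt0; apply: leq_trans mS.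
elim: s c => // x s IHs c /= /andP[xs us] /andP[ns gs] _.
rewrite !big_cons => ev le.
have cxS : c x <= #|S| by rewrite -ltnS; apply: leq_trans le; rewrite leq_addr.
have xNs z : z \in s -> (z == x) = false by apply: contraTF => /eqP->.
(* If [c x] is odd, the rest of the fibre over [x] can be matched internally, and [(c x).+1] is
   even, so the parity condition passes to [s]. *)
have [ox|ex] := boolP (odd (c x)).
  have [|k kS] := Sn0 (c x); first by rewrite odd_gt0.
  have [Rx [_ sRx cRx mRx]] := fiber_remove kS ox cxS.
  have mx := matchable_fiber x mRx.
  have [s0|s0] := eqVneq s [::].
    exists (fun=> Rx); subst s; split=> [z|]; first by rewrite inE => /eqP->.
    congr (matchable _ _): mx; by apply/setP => -[z l]; rewrite !inE.
  have [||R [RP mR]] := IHs c us gs s0.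
  - by move: ev; rewrite oddD /= ox.
  - by apply: leq_trans le; rewrite leq_addl.
  exists (fun z => if z == x then Rx else R z); split=> [z|].
    rewrite inE; case: eqVneq => [-> //|_ /=]; exact: RP.
  suff D : [disjoint [set u | (u.1 == x) && (u.2 \in S :\: Rx)]
                   & [set u | (u.1 \in s) && (u.2 \in S :\: R u.1)]].
    congr (matchable _ _): (matchableU D mx mR); apply/setP => -[z l].
    rewrite !inE /=.
    by case: eqVneq => [->|_]; rewrite ?(negPf xs) ?orbF.
  rewrite disjoint_subset; apply/subsetP => -[z l]; rewrite !inE /=.
  by case/andP => /eqP-> _; rewrite (negPf xs).
have s0 : s != [::].
  by apply: contraNneq ev => ->; rewrite big_nil addn0 /= ex.
have /hasP[y ys xy] : has (eV x) s by case: (s) s0 ns.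
have yx := xNs _ ys.
(* If [c x] is even, one more point of the fibre over [x] is left out and matched to the fibre over
   the neighbour [y], which must reserve one more point. The sum over [s] rises by 1: it becomes
   even and still fits the bound. *)
pose c' z := c z + (z == y).
have sc' : \sum_(z <- s) (c' z).+1 = (\sum_(z <- s) (c z).+1).+1.
  rewrite /c' (bigD1_seq y) //= [in RHS](bigD1_seq y) //= eqxx addn1 !addSn.
  do 2! congr _.+1; congr (_ + _); apply: eq_bigr => z /negPf->.
  by rewrite addn0.
have [||R [RP mR]] := IHs c' us gs s0.
- by move: ev; rewrite sc' oddD /= ex /= negbK => ->.
- by rewrite sc'; apply: leq_trans le; rewrite addSn ltnS leq_addl.
have [sRy] := RP y ys; rewrite /c' eqxx addn1 => cRy.
(* The link [(x, k)]--[(y, k)] uses a point [k] reserved over [y]; factor-criticality then gives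
   [Rx] of odd size [(c x).+1] containing that [k]. *)
have [k kR] : exists k, k \in R y by apply/set0Pn; rewrite -card_gt0 cRy.
have kS := subsetP sRy k kR.
have [||Rx [kRx sRx cRx mRx]] := @fiber_remove (c x).+1 k kS.
- by rewrite /= ex.
(* [y] contributes at least 1 to the sum, which leaves room for [(c x).+1 <= #|S|]. *)
- rewrite -ltnS; apply: leq_trans le.
  by rewrite -[X in X <= _]addn1 leq_add2l (bigD1_seq y).
have mx := matchable_fiber x mRx.
have me : matchable box_rel [set (x, k); (y, k)].
  apply: matchable2; [exact: box_rel_sym|exact: box_rel_irrefl|].
  by rewrite /box_rel /= eqxx xy orbT.
exists (fun z => if z == x then Rx :\ k else if z == y then R y :\ k else R z).
split=> [z|].
  rewrite inE; case: (eqVneq z x) => [-> _|_ /=].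
    rewrite (subset_trans (subD1set _ _) sRx); split=> //.
    by apply/eqP; rewrite -eqSS -cRx (cardsD1 k Rx) kRx.
  case: (eqVneq z y) => [-> _|zy /RP[]].
    rewrite (subset_trans (subD1set _ _) sRy); split=> //.
    by apply/eqP; rewrite -eqSS -cRy (cardsD1 k (R y)) kR.
  by rewrite /c' (negPf zy) addn0.
set X := [set u | _] in mx; set E := [set _; _] in me; set Y := [set u | _] in mR.
have dXE : [disjoint X & E].
  rewrite disjoint_subset; apply/subsetP => -[z l]; rewrite !inE /= !xpair_eqE.
  case/andP=> /eqP-> /andP[lRx _]; rewrite eqxx [x == y]eq_sym yx /= orbF.
  by apply: contra lRx => /eqP->.
have dXEY : [disjoint X :|: E & Y].
  rewrite disjoint_subset; apply/subsetP => -[z l]; rewrite !inE /= !xpair_eqE.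
  case/orP=> [/andP[/eqP-> _]|/orP[]/andP[/eqP-> /eqP->]]; rewrite ?(negPf xs) //.
  by rewrite kR andbF.
congr (matchable _ _): (matchableU dXEY (matchableU dXE mx me) mR).
apply/setP => -[z l]; rewrite !inE /= !xpair_eqE.
case: (eqVneq z x) => [->|_] /=.
  rewrite (negPf xs) [x == y]eq_sym yx /= !orbF !inE.
  by case: (eqVneq l k) => [->|_] //=; rewrite ?kS ?orbT ?orbF.
case: (eqVneq z y) => [->|_] //=.
by rewrite ys /= !inE; case: (eqVneq l k) => [->|_] //=; rewrite ?kS ?orbT ?orbF.
Qed.

Lemma matchable_box_rel : (forall x y, connect eV x y) -> 0 < #|V| ->
  ~~ odd #|V| -> #|V| <= #|S|.+1 ->
  matchable box_rel [set u | u.2 \in S].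
Proof.
move=> /connected_grown[s [us gs sT]] V0 ev le.
have cs : \sum_(x <- s) 1 = #|V|.
  by rewrite sum1_size -(card_uniqP us); apply: eq_card => x; rewrite sT inE.
(* With no point reserved, the sum is [#|V|] and every [R x] is empty. *)
have [|||R [RP mR]] := @matchable_grown s (fun=> 0) us gs.
- by apply: contraTneq V0 => s0; rewrite -cs s0 big_nil.
- by rewrite cs.
- by rewrite cs.
congr (matchable _ _): mR; apply/setP => u; rewrite !inE sT /=.
by have [_ /eqP] := RP u.1 (sT _); rewrite cards_eq0 => /eqP->; rewrite inE.
Qed.

End GrowProduct.

(** * Boxes in the Cartesian product *)

Section CartesianProduct.
Variables (t : nat) (H : 'I_t -> sgraph).
Local Notation G := {dffun forall i : 'I_t, H i}.
Implicit Types (u p : G) (i j : 'I_t) (S : forall i, {set H i}).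

Definition upd u i (x : H i) : G := finfun (dfwith u x).

Lemma upd_in u i (x : H i) : upd u x i = x.
Proof. by rewrite ffunE dfwith_in. Qed.

Lemma upd_out u i (x : H i) j : i != j -> upd u x j = u j.
Proof. by move=> ij; rewrite ffunE dfwith_out. Qed.

Lemma upd_upd u i (x y : H i) : upd (upd u x) y = upd u y.
Proof.
apply/ffunP => j; have [<-|ij] := eqVneq i j; first by rewrite !upd_in.
by rewrite !upd_out.
Qed.

Lemma upd_id u i : upd u (u i) = u.
Proof.
apply/ffunP => j; have [<-|ij] := eqVneq i j; first by rewrite upd_in.
by rewrite upd_out.
Qed.

Lemma cart_adj_upd u i (x : H i) : adj (u i) x -> cart_adj u (upd u x).
Proof.
move=> ux; apply/existsP; exists i; rewrite upd_in ux andbT.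
by apply/forallP => j; apply/implyP => ji; rewrite upd_out // eq_sym.
Qed.

Definition box (S : forall i, {set H i}) : {set G} :=
  [set u : G | [forall i, u i \in S i]].

Lemma boxP S u : reflect (forall i, u i \in S i) (u \in box S).
Proof. by rewrite inE; apply: forallP. Qed.

Lemma box_upd S u i (x : H i) : u \in box S -> x \in S i -> upd u x \in box S.
Proof.
move=> /boxP uS xS; apply/boxP => j.
by have [<-|ij] := eqVneq i j; rewrite ?upd_in // upd_out.
Qed.

Lemma matchable_box S i :
  matchable (@adj (H i)) (S i) -> matchable (@cart_adj t H) (box S).
Proof.
case=> f fP; exists (fun u => upd u (f (u i))) => u uS.
have [fS ff ux] := fP (u i) (boxP _ _ uS i).
by split; [exact: box_upd|rewrite upd_in upd_upd ff upd_id|exact: cart_adj_upd].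
Qed.

(* [u] is matched along the first coordinate in which it differs from [p] *)
Lemma factor_critical_box S :
  (forall i, factor_critical (@adj (H i)) (S i)) ->
  factor_critical (@cart_adj t H) (box S).
Proof.
move=> fcS p /boxP pS.
have /fin_all_exists[f fP] i : exists f : H i -> H i,
  {in S i :\ p i, forall x, [/\ f x \in S i :\ p i, f (f x) = x & adj x (f x)]}.
  exact: fcS.
pose first u i := (u i != p i) && [forall j : 'I_t, (j < i) ==> (u j == p j)].
have first_uniq u i j : first u i -> first u j -> i = j.
  move=> /andP[ui /forallP Ui] /andP[uj /forallP Uj]; apply/val_inj.
  case: (ltngtP i j) => // [/(implyP (Uj i))|/(implyP (Ui j))].
    by rewrite (negPf ui).
  by rewrite (negPf uj).
have first_ex u : u != p -> exists i, first u i.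
  move=> up; have [i ui] : exists i, u i != p i.
    apply/existsP; rewrite -negb_forall; apply: contra up => /forallP up.
    by apply/eqP/ffunP => i; apply/eqP.
  case: (@arg_minnP _ i (fun k => u k != p k) (fun k : 'I_t => k : nat) ui) => k uk kmin.
  exists k; rewrite /first uk; apply/forallP => j; apply/implyP.
  by apply: contraTT => /kmin; rewrite -leqNgt.
pose F u := if [pick i | first u i] is Some i then upd u (f i (u i)) else u.
have FE u i : first u i -> F u = upd u (f i (u i)).
  move=> ui; rewrite /F; case: pickP => [j uj|/(_ i)]; last by rewrite ui.
  by rewrite (first_uniq _ _ _ ui uj).
exists F => u /setD1P[up uS]; have [i ui] := first_ex u up.
have [uip /forallP Ui] := andP ui.
have [|fS ff ux] := fP i (u i); first by rewrite in_setD1 uip (boxP _ _ uS).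
move: (fS); rewrite in_setD1 => /andP[fp fSi].
(* The partner agrees with [u] before [i] and still avoids [p i] at [i], so it selects the same
   coordinate; hence [F] is an involution. *)
have ui' : first (upd u (f i (u i))) i.
  rewrite /first upd_in fp; apply/forallP => j; apply/implyP => ji.
  by rewrite upd_out ?(implyP (Ui j)) // neq_ltn ji orbT.
rewrite (FE _ _ ui) (FE _ _ ui') upd_upd upd_in ff upd_id; split=> //.
  rewrite in_setD1 box_upd // andbT; apply: contraNneq fp => E.
  by rewrite -E upd_in.
exact: cart_adj_upd.
Qed.

(* Count a base point and its modifications in one coordinate other than [i0]. *)
Lemma card_box S i0 : (forall i, i != i0 -> 1 < #|S i|) -> 0 < #|S i0| ->
  t <= #|box S|.
Proof.
move=> S2 S0.
have /fin_all_exists[p pS] i : exists x, x \in S i.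
  by apply/set0Pn; rewrite -card_gt0; have [->|/S2/ltnW] := eqVneq i i0.
have /fin_all_exists[q qS] i :
      exists x, (x \in S i) && ((i != i0) ==> (x != p i)).
  have [->|ii] := eqVneq i i0; first by exists (p i0); rewrite pS.
  have [x] : exists x, x \in S i :\ p i.
    by apply/set0Pn; rewrite -card_gt0; move: (S2 i ii); rewrite (cardsD1 (p i)) pS.
  by rewrite in_setD1 => /andP[xp xS]; exists x; rewrite xS xp.
pose P : G := finfun p.
have PS : P \in box S by apply/boxP => i; rewrite ffunE.
pose g i := if i == i0 then P else upd P (q i).
have gI : injective g.
  (* Outside [i0], [g i] leaves the base point exactly in coordinate [i], which recovers [i]; [g i0]
     is the base point itself. *)
  have gE i j : j != i0 -> (g i j == p j) = (j != i).
    move=> jj; rewrite /g; have [->|ii] := eqVneq i i0; first by rewrite ffunE eqxx.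
    have [->|ji] := eqVneq j i; last by rewrite upd_out 1?eq_sym // ffunE eqxx.
    by rewrite upd_in; have /andP[_] := qS i; rewrite ii => /negPf->.
  move=> i j E; apply/eqP; have [ii|ii] := eqVneq i i0.
    have [jj|jj] := eqVneq j i0; first by rewrite ii jj.
    by have := gE i j jj; rewrite E gE // eqxx eq_sym => /esym/negbFE.
  by have := gE j i ii; rewrite -E gE // eqxx => /esym/negbFE.
rewrite -[X in X <= _](card_ord t) -(card_imset _ gI); apply: subset_leq_card.
apply/subsetP => _ /imsetP[i _ ->]; rewrite /g; case: ifP => // _.
by apply: box_upd; have /andP[] := qS i.
Qed.

End CartesianProduct.

(** * Matching the product when one factor has even order *)

Section EvenFactor.
Variables (t : nat) (H : 'I_t -> sgraph) (i0 : 'I_t).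
Variable s : forall i, {perm H i}.
Hypothesis adj_s : forall i x, adj x (s i x).
Local Notation G := {dffun forall i : 'I_t, H i}.
Implicit Types (S : forall i, {set H i}).


Lemma matchable_cart_prod : connected_graph (H i0) -> ~~ odd #|H i0| ->
  #|H i0| <= t -> matchable (@cart_adj t H) setT.
Proof.
move=> [V0 conn] ev le.
(* [b u] lists the sides of the piece containing [u]: all of [H i0], and the orbit of [u i]
   elsewhere. Its fibres are boxes. *)
pose b (u : G) : {dffun forall i, {set H i}} :=
  [ffun i => if i == i0 then setT else porbit (s i) (u i)].
apply: (@matchable_bigcup _ _ _ b) => k.
have [->|[u0]] := set_0Vmem [set u in setT | b u == k]; first exact: matchable0.
rewrite inE => /andP[_ /eqP bk].
have -> : [set u in setT | b u == k] = box k.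
  apply/setP => u; rewrite !inE -bk /=; apply/eqP/forallP => [E i|uk].
    by rewrite -E ffunE; case: ifP => _; rewrite ?inE ?porbit_id.
  apply/ffunP => i; have := uk i; rewrite !ffunE; case: ifP => // _.
  by rewrite -eq_porbit_mem => /eqP.
have [/existsP[j /andP[ji oj]]|/existsPn allodd] :=
  boolP [exists j, (j != i0) && ~~ odd #|k j|].
  apply: (@matchable_box _ _ _ j); move: oj.
  rewrite -bk ffunE (negPf ji).
  by apply: matchable_porbit => //; [exact: adj_sym|exact: adj_irrefl].
have kE i : i != i0 -> k i = porbit (s i) (u0 i) by move=> ii; rewrite -bk ffunE (negPf ii).
have k0E : k i0 = setT by rewrite -bk ffunE eqxx.
(* [K] is realised as a slice of [G] itself, with coordinate [i0] frozen at [u0 i0]; a single point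
   is trivially factor-critical, so the slice is a box of factor-critical sets. *)
pose S i := if i == i0 then [set u0 i] else k i.
have SE (v : G) : v \in box S -> v i0 = u0 i0.
  by move=> /boxP/(_ i0); rewrite /S eqxx inE => /eqP.
have fcS : factor_critical (@cart_adj t H) (box S).
  apply: factor_critical_box => i; rewrite /S; case: eqVneq => [_|ii].
    move=> p; rewrite inE => /eqP->; rewrite setDv; exact: matchable0.
  rewrite kE //; apply: factor_critical_porbit => //.
  - exact: adj_sym.
  - exact: adj_irrefl.
  by have := allodd i; rewrite ii kE //= negbK.
have leS : t <= #|box S|.
  apply: (@card_box _ _ _ i0) => [i ii|]; last by rewrite /S eqxx cards1.
  rewrite /S (negPf ii) kE //; apply/card_gt1P.
  (* An orbit has at least two points, since [s i] moves every vertex to a neighbour. *)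
  exists (u0 i), (s i (u0 i)); split; [exact: porbit_id|exact: (mem_porbit _ 1)|].
  by apply: contraTneq (adj_s (u0 i)) => <-; rewrite adj_irrefl.
have m := @matchable_box_rel _ _ (@adj (H i0)) (@cart_adj t H)
  (@adj_sym _) (@adj_irrefl _) (@cart_adj_sym _ _) (@cart_adj_irrefl _ _)
  _ fcS conn V0 ev (leqW (leq_trans le leS)).
pose g (z : H i0 * G) := upd z.2 z.1.
have -> : box k = g @: [set z | z.2 \in box S].
  apply/setP => u; apply/idP/imsetP => [/boxP uk|[[v w]]].
    exists (u i0, upd u (u0 i0)); last by rewrite /g /= upd_upd upd_id.
    rewrite inE; apply/boxP => i; rewrite /S; case: eqVneq => [->|ii].
      by rewrite upd_in inE.
    by rewrite upd_out // eq_sym.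
  rewrite inE /= => /boxP wS ->; apply/boxP => i; rewrite /g /=.
  have [->|ii] := eqVneq i i0; first by rewrite k0E inE.
  by have := wS i; rewrite /S (negPf ii) upd_out // eq_sym.
have DE z : z \in [set z : H i0 * G | z.2 \in box S] -> z.2 i0 = u0 i0.
  by rewrite inE => /SE.
apply: matchable_imset m => [[v w] [v' w'] /DE/= w0 /DE/= w0'|[v w] [v' w'] /DE/= w0 /DE/= w0'].
  rewrite /g /= => E; have vv : v = v' by rewrite -(upd_in w v) E upd_in.
  congr pair => //; rewrite -[w](upd_id w i0) -[w'](upd_id w' i0) w0 w0'.
  by rewrite -(upd_upd w v) E upd_upd.
rewrite /g /box_rel /= => /orP[]/andP[/eqP <-]; last first.
  by move=> vv; rewrite -(upd_upd w v v'); apply: cart_adj_upd; rewrite upd_in.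
case/existsP => i /andP[/forallP ww a]; apply/existsP; exists i.
have ii : i0 != i by apply: contraTneq a => <-; rewrite w0 w0' adj_irrefl.
rewrite !upd_out // a andbT; apply/forallP => j; apply/implyP => ji.
have [<-|ij] := eqVneq i0 j; first by rewrite !upd_in.
by rewrite !upd_out //; apply: (implyP (ww j)).
Qed.

End EvenFactor.

(** * From involutions to edge sets, and the conclusion *)

Lemma matchable_perfect (G : sgraph) : matchable (@adj G) setT ->
  exists M : {set {set G}}, perfect_matching M.
Proof.
move=> [f fP]; have ff x : f (f x) = x by have [] := fP x (in_setT x).
have af x : adj x (f x) by have [] := fP x (in_setT x).
(* A pair is determined by any one of its points, so two pairs that meet are equal. *)
have blockE x z : z \in [set x; f x] -> [set z; f z] = [set x; f x].
  by rewrite !inE => /orP[]/eqP-> //; rewrite ff setUC.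
exists [set [set x; f x] | x : G]; split; [split|].
- apply/subsetP => _ /imsetP[x _ ->]; apply/imsetP; exists (x, f x) => //.
  by rewrite inE /=.
- apply/trivIsetP => _ _ /imsetP[x _ ->] /imsetP[y _ ->]; apply: contraR.
  by move=> /pred0Pn[z /andP[/= zx zy]]; rewrite -(blockE x z) // (blockE y z).
- apply/setP => x; rewrite inE; apply/bigcupP; exists [set x; f x].
    exact: imset_f.
  by rewrite set21.
Qed.

(** The first step of a path between two distinct vertices provides a neighbour. *)
Lemma regular_connected_gt0 (G : sgraph) d :
  regular G d -> connected_graph G -> 1 < #|G| -> 0 < d.
Proof.
move=> regG [_ conn] /card_gt1P[x [y [_ _ xy]]].
have /connectP[[|z p] /= pth E] := conn x y; first by rewrite E eqxx in xy.
rewrite -(regG x) card_gt0; apply/set0Pn; exists z; rewrite inE.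
by case/andP: pth.
Qed.

Theorem theorem1p1 (R : realType) (C : R) (hC : (1 < C)%R)
    (t : nat) (ht : (5 * C <= t%:R)%R)
    (H : 'I_t -> sgraph) (d : 'I_t -> nat)
    (Hconn : forall i : 'I_t, connected_graph (H i))
    (Hreg : forall i : 'I_t, regular (H i) (d i))
    (Hcard : forall i : 'I_t, 1 < #|H i| /\ (#|H i|%:R <= C)%R)
    (Heven : ~~ odd #|cart_prod H|) :
  exists M : {set {set cart_prod H}}, perfect_matching M.
Proof.
(* If all factors had odd order, so would their product. *)
have [i0 ev] : exists i, ~~ odd #|H i|.
  apply/existsP; rewrite -negb_forall; apply: contra Heven => /forallP allodd.
  rewrite card_dep_ffun foldrE big_map; elim/big_ind: _ => // m n om on.
  by rewrite oddM om on.
have /fin_all_exists[s sP] i : exists s : {perm H i}, forall x, adj x (s x).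
  apply: regular_perm (Hreg i) _.
  by apply: regular_connected_gt0 (Hreg i) (Hconn i) _; have [] := Hcard i.
apply: matchable_perfect; apply: (matchable_cart_prod sP (Hconn i0) ev).
(* [#|H i0| <= C <= 5 * C <= t], the middle inequality because [C] is positive. *)
rewrite -(ler_nat R); have [_ le] := Hcard i0; apply: le_trans le _.
apply: le_trans ht; rewrite ler_peMl ?ler1n //.
by apply: ltW; apply: lt_trans hC.
Qed.
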